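(* Let $z>0$, let $\Phi$ be the standard normal distribution function, let $f_z$ be the unique bounded solution of the Stein equation $f'(w)-wf(w)=\mathbf{1}(w\le z)-\Phi(z)$, and let $g_z(w)=(wf_z(w))'$, that is, $$g_z(w)=\begin{cases}\left(\sqrt{2\pi}(1+w^2)e^{w^2/2}(1-\Phi(w))-w\right)\Phi(z) & \text{if } w>z,\\ \left(\sqrt{2\pi}(1+w^2)e^{w^2/2}\Phi(w)+w\right)(1-\Phi(z)) & \text{if } w\le z.\end{cases}$$ Then: (i) $g_z(w)$ is increasing for $w\le z$ and decreasing for $w>z$; (ii) $g_z(w)\le \dfrac{3}{2(1-w)^3}$ for all $w<0$; (iii) $g_z(w)\le \dfrac{3}{(1+w)^3}$ for all $w>z$.
   Context: $\Phi(z)=\frac{1}{\sqrt{2\pi}}\int_{-\infty}^z e^{-t^2/2}\,dt$. The function $f_z$ is differentiable except at $w=z$; at $w=z$ the value of $g_z$ is given by the convention in the displayed formula (second case). *)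

(* Defs.v *)
From HB Require Import structures.
From mathcomp Require Import all_boot all_order all_algebra.
From mathcomp Require Import all_classical all_reals all_analysis.

Set Implicit Arguments.
Unset Strict Implicit.
Unset Printing Implicit Defensive.

Import Order.TTheory GRing.Theory Num.Theory.
Import numFieldNormedType.Exports.

Local Open Scope classical_set_scope.
Local Open Scope ring_scope.

Definition Phi {R : realType} (x : R) : R :=
  (Num.sqrt (2 * pi))^-1 *
  \int[lebesgue_measure]_(t in `]-oo, x]) expR (- t ^+ 2 / 2).

(* The right-hand side jumps at [z], so the equation can only be required away
   from [z]; there, [f] is only required to be continuous. *)
Definition bounded_stein_solution {R : realType} (z : R) (f : R -> R) : Prop :=
  [/\ continuous f,
      bounded_fun f &
      forall w : R, w != z ->
        derivable f w 1 /\ derive1 f w - w * f w = (w <= z)%R%:R - Phi z].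

Definition stein_g_formula {R : realType} (z w : R) : R :=
  if z < w then
    (Num.sqrt (2 * pi) * (1 + w ^+ 2) * expR (w ^+ 2 / 2) * (1 - Phi w) - w)
    * Phi z
  else
    (Num.sqrt (2 * pi) * (1 + w ^+ 2) * expR (w ^+ 2 / 2) * Phi w + w)
    * (1 - Phi z).

(* [w * f w] need not be differentiable at [w = z], where the value is given by
   convention. *)
Definition stein_g {R : realType} (z : R) (f : R -> R) (w : R) : R :=
  if w == z then stein_g_formula z z
  else derive1 (fun x : R => x * f x) w.

(* Main.v *)
Require Import Defs.
From HB Require Import structures.
From mathcomp Require Import all_boot all_order all_algebra.
From mathcomp Require Import all_classical all_reals all_analysis.
From mathcomp Require Import ring lra.

Import Order.TTheory GRing.Theory Num.Theory.
Import numFieldNormedType.Exports.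

Local Open Scope classical_set_scope.
Local Open Scope ring_scope.

(* Write M(x) = sqrt(2 pi) e^(x^2/2) (1 - Phi x) for the Mills ratio, so that
   M' = x M - 1 and M(-x) = sqrt(2 pi) e^(x^2/2) Phi x.  With
   h(x) = (1 + x^2) M(x) - x, the function g_z is h(w) Phi(z) for w > z and
   h(-w) (1 - Phi(z)) for w <= z.  If U >= 0 and U' < x U - 1 on (0, oo), then
   (U - M) e^(-x^2/2) decreases there to a nonnegative limit, hence M < U.
   Taking U = (x^2 + 2) / (x^3 + 3 x) gives h' < 0 on (0, oo), while h' < 0 is
   clear on (-oo, 0]; taking U = (x + 3 / (1 + x)^3) / (1 + x^2) gives
   h(x) < 3 / (1 + x)^3 for x > 0, and Phi(z) >= 1/2 supplies the extra factor
   in (ii).  Two bounded solutions of the Stein equation differ by a multiple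
   of e^(w^2/2), which is unbounded. *)

Section normal_cdf.
Context {R : realType}.
Local Notation mu := (@lebesgue_measure R).
Implicit Types x y z w : R.

Lemma normal_pdf01E x :
  normal_pdf 0 1 x = (Num.sqrt (2 * pi))^-1 * expR (- x ^+ 2 / 2).
Proof.
rewrite normal_pdfE ?oner_neq0// /normal_peak /normal_fun.
by rewrite subr0 expr1n mul1r mulr_natl.
Qed.

Lemma PhiE x : Phi x = fine (normal_prob (0 : R) 1 `]-oo, x]).
Proof.
have intE : mu.-integrable `]-oo, x] (EFin \o (fun t => expR (- t ^+ 2 / 2))).
  have -> : EFin \o (fun t : R => expR (- t ^+ 2 / 2)) =
      (fun t => (Num.sqrt (2 * pi))%:E * (normal_pdf 0 1 t)%:E)%E.
    apply/funext => t; rewrite /= normal_pdf01E -EFinM mulrA divff ?mul1r//.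
    by rewrite gt_eqF// sqrtr_gt0 mulr_gt0// pi_gt0.
  apply: integrableZl => //.
  exact: integrableS (integrable_normal_pdf _ _).
rewrite /Phi -RintegralZl//; congr fine.
by apply: eq_integral => t _; rewrite normal_pdf01E.
Qed.

Let X : measurableTypeR R -> R := idfun.
#[local] HB.instance Definition _ :=
  @isMeasurableFun.Build _ _ _ _ X (@measurable_id _ _ setT).

Lemma cvg_Phi_y : Phi x @[x --> +oo] --> (1 : R).
Proof.
have -> : Phi = fine \o cdf (X : {RV (normal_prob (0 : R) 1) >-> R}).
  by apply/funext => x; rewrite PhiE.
exact/fine_cvg/cvg_cdfy1.
Qed.

Lemma cvg_Phi_Ny : Phi x @[x --> -oo] --> (0 : R).
Proof.
have -> : Phi = fine \o cdf (X : {RV (normal_prob (0 : R) 1) >-> R}).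
  by apply/funext => x; rewrite PhiE.
exact/fine_cvg/cvg_cdfNy0.
Qed.

#[global] Instance is_derive_Phi x :
  is_derive x 1 Phi ((Num.sqrt (2 * pi))^-1 * expR (- x ^+ 2 / 2)).
Proof.
rewrite -normal_pdf01E.
have -> : Phi = (fun x => \int[mu]_(t in `]-oo, x]) normal_pdf 0 1 t).
  by apply/funext => y; rewrite PhiE.
have [||||d <-] := @continuous_FTC1 R (normal_pdf 0 1) -oo%O x (x + 1).
- by rewrite ltrDl.
- exact: integrableS (integrable_normal_pdf _ _).
- by rewrite ltNyr.
- exact: continuous_normal_pdf (oner_neq0 _) x.
- by rewrite derive1E; apply: DeriveDef.
Qed.

End normal_cdf.

Section mills_ratio.
Context {R : realType}.
Implicit Types x y z w : R.

Lemma is_derive_continuous (f : R -> R) x d :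
  is_derive x 1 f d -> {for x, continuous f}.
Proof. by move=> [df _]; apply: differentiable_continuous; apply/derivable1_diffP. Qed.

Lemma derive_neg_decreasing (f df : R -> R) (a b : R) :
  (forall x, a <= x <= b -> is_derive x 1 f (df x)) ->
  (forall x, a <= x <= b -> df x < 0) ->
  a < b -> f b < f a.
Proof.
move=> fdf df0 ab.
have [c cab fE] : exists2 c, c \in `]a, b[ & f b - f a = df c * (b - a).
  apply: MVT => //.
    move=> x; rewrite in_itv/= => /andP[ax xb]; apply: fdf; rewrite !ltW//.
  apply: continuous_in_subspaceT => x; rewrite inE/= in_itv/= => xab.
  exact: is_derive_continuous (fdf x xab).
move: cab; rewrite in_itv/= => /andP[ac cb].
by rewrite -subr_lt0 fE pmulr_llt0 ?subr_gt0// df0// !ltW.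
Qed.

Lemma expR_sqr_halfM x : expR (- x ^+ 2 / 2) * expR (x ^+ 2 / 2) = 1.
Proof. by rewrite -expRD mulNr addNr expR0. Qed.

Lemma sqrt2pi_gt0 : 0 < Num.sqrt (2 * pi) :> R.
Proof. by rewrite sqrtr_gt0 mulr_gt0// pi_gt0. Qed.

Lemma is_derive_expR_sqr_half x :
  is_derive x 1 (fun t : R => expR (t ^+ 2 / 2)) (x * expR (x ^+ 2 / 2)).
Proof.
have h : is_derive x 1 (fun t : R => t ^+ 2 / 2) x.
  apply: is_derive_eq; rewrite /GRing.scale/=; lra.
have := @is_derive1_comp R expR (fun t : R => t ^+ 2 / 2) x _ _ (is_derive_expR _) h.
by rewrite mulrC.
Qed.

Lemma is_derive_expRN_sqr_half x :
  is_derive x 1 (fun t : R => expR (- t ^+ 2 / 2)) (- x * expR (- x ^+ 2 / 2)).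
Proof.
have h : is_derive x 1 (fun t : R => - t ^+ 2 / 2) (- x).
  apply: is_derive_eq; rewrite /GRing.scale/=; lra.
have := @is_derive1_comp R expR (fun t : R => - t ^+ 2 / 2) x _ _ (is_derive_expR _) h.
by rewrite mulrC.
Qed.

Lemma Phi_increasing x y : x < y -> Phi x < Phi y.
Proof.
move=> xy; rewrite -ltrN2.
apply: (@derive_neg_decreasing (fun t => - Phi t)
  (fun t => - ((Num.sqrt (2 * pi))^-1 * expR (- t ^+ 2 / 2)))) => // t _.
by rewrite oppr_lt0 mulr_gt0 ?invr_gt0 ?sqrt2pi_gt0 ?expR_gt0.
Qed.

Lemma PhiN x : Phi (- x) = 1 - Phi x.
Proof.
pose S t : R := Phi t + Phi (- t).
have dS (t : R) : is_derive t 1 S 0.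
  have h : is_derive t 1 (fun t => Phi (- t))
      (((Num.sqrt (2 * pi))^-1 * expR (- (- t) ^+ 2 / 2)) * -1).
    exact: (@is_derive1_comp R Phi -%R).
  by apply: is_derive_eq; rewrite sqrrN mulrN1 subrr.
have S1 : S t @[t --> +oo] --> (1 : R).
  rewrite -[1]addr0; apply: cvgD; first exact: cvg_Phi_y.
  by rewrite -(cvgNy_compNP Phi); exact: cvg_Phi_Ny.
have Sc : S t @[t --> +oo] --> S x.
  rewrite (_ : S = cst (S x)); first exact: cvg_cst.
  by apply/funext => t; exact: is_derive_0_is_cst.
have := cvg_unique _ S1 Sc; rewrite /S => ->//; ring.
Qed.

Lemma Phi_gt0 x : 0 < Phi x.
Proof.
apply: (@le_lt_trans _ _ (Phi (x - 1))); first by rewrite PhiE fine_ge0.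
by apply: Phi_increasing; rewrite ltrBlDr ltrDl.
Qed.

Lemma Phi_lt1 x : Phi x < 1.
Proof. by rewrite -subr_gt0 -PhiN Phi_gt0. Qed.

Lemma Phi_ge_half x : 0 <= x -> 2^-1 <= Phi x.
Proof.
have Phi0 : Phi 0 = 2^-1 :> R by have := @PhiN 0; rewrite oppr0; lra.
by rewrite le_eqVlt => /predU1P[<-|/Phi_increasing/ltW]; rewrite Phi0.
Qed.

Definition mills x : R := Num.sqrt (2 * pi) * expR (x ^+ 2 / 2) * (1 - Phi x).

Lemma is_derive_mills x : is_derive x 1 mills (x * mills x - 1).
Proof.
have dE := is_derive_expR_sqr_half x.
apply: is_derive_eq; rewrite /mills /GRing.scale/= /cst/=.
have := expR_sqr_halfM x.
have := sqrt2pi_gt0.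
set s := Num.sqrt _; set u := expR _; set v := expR _ => s0 uv.
rewrite [LHS](_ : _ = x * (s * v * (1 - Phi x)) - (s / s) * (u * v)); last by ring.
by rewrite uv mulr1 divff ?gt_eqF.
Qed.

Lemma mills_gt0 x : 0 < mills x.
Proof.
by rewrite !mulr_gt0 ?sqrt2pi_gt0 ?expR_gt0// subr_gt0 Phi_lt1.
Qed.

Lemma mills_lt (U dU : R -> R) :
  (forall x, 0 < x -> is_derive x 1 U (dU x)) ->
  (forall x, 0 < x -> 0 <= U x) ->
  (forall x, 0 < x -> dU x < x * U x - 1) ->
  forall x, 0 < x -> mills x < U x.
Proof.
move=> UdU U0 dUlt x x0.
pose T t : R := Num.sqrt (2 * pi) * (1 - Phi t).
pose E t := U t * expR (- t ^+ 2 / 2) - T t.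
pose dE t := (dU t - t * U t + 1) * expR (- t ^+ 2 / 2).
have EdE (t : R) : 0 < t -> is_derive t 1 E (dE t).
  move=> t0; have dUt := UdU t t0; have dN := is_derive_expRN_sqr_half t.
  apply: is_derive_eq; rewrite /dE /GRing.scale/= /cst/=.
  have := sqrt2pi_gt0; set s := Num.sqrt _; set u := expR _ => s0.
  rewrite [LHS](_ : _ = (dU t - t * U t + s / s) * u); last by ring.
  by rewrite divff ?gt_eqF.
have Edecr a b : 0 < a -> a < b -> E b < E a.
  move=> a0; apply: (@derive_neg_decreasing E dE) => t /andP[la _].
    exact/EdE/(lt_le_trans a0).
  have t0 := lt_le_trans a0 la.
  by rewrite pmulr_llt0 ?expR_gt0//; have := dUlt t t0; lra.
have T0 : - T t @[t --> +oo] --> (0 : R).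
  rewrite -oppr0 -(mulr0 (Num.sqrt (2 * pi))) -(subrr 1).
  apply: cvgN; apply: cvgM; first exact: cvg_cst.
  apply: cvgB; first exact: cvg_cst.
  exact: cvg_Phi_y.
have Ex0 : 0 < E x.
  apply: (@le_lt_trans _ _ (E (x + 1))); last by apply: Edecr => //; rewrite ltrDl.
  apply: (cvgr_to_le T0); near=> t.
  have xt : x + 1 < t by near: t; apply: nbhs_pinfty_gt; exact: num_real.
  have x10 : 0 < x + 1 by rewrite addr_gt0.
  apply: le_trans (ltW (Edecr _ _ x10 xt)).
  by rewrite /E lerDr mulr_ge0 ?expR_ge0// U0// (lt_trans x10).
rewrite -subr_gt0.
suff -> : U x - mills x = E x * expR (x ^+ 2 / 2) by rewrite mulr_gt0 ?expR_gt0.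
rewrite /E /T /mills mulrBl -[U x * _ * _]mulrA expR_sqr_halfM; ring.
Unshelve. all: by end_near. Qed.

Lemma mills_lt_rational x : 0 < x -> (x ^+ 3 + 3 * x) * mills x < x ^+ 2 + 2.
Proof.
move=> x0; have q0 t : 0 < t -> 0 < t ^+ 3 + 3 * t :> R.
  by move=> t0; rewrite addr_gt0 ?exprn_gt0 ?mulr_gt0.
rewrite mulrC -ltr_pdivlMr ?q0//.
pose dU (t : R) := (2 * t * (t ^+ 3 + 3 * t) - (t ^+ 2 + 2) * (3 * t ^+ 2 + 3))
  / (t ^+ 3 + 3 * t) ^+ 2.
apply: (@mills_lt (fun t => (t ^+ 2 + 2) / (t ^+ 3 + 3 * t)) dU) => // t t0.
- have qt := q0 t t0; have qn : t ^+ 3 + 3 * t != 0 by rewrite gt_eqF.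
  by apply: is_derive_eq; rewrite /dU /GRing.scale/= /cst/=; field.
- by rewrite /= divr_ge0 ?ltW ?q0// addr_gt0 ?exprn_gt0.
- have qt := q0 t t0; have qn : t ^+ 3 + 3 * t != 0 by rewrite gt_eqF.
  rewrite /= -subr_lt0 (_ : _ - _ = - 6 / (t ^+ 3 + 3 * t) ^+ 2); last by rewrite /dU; field.
  by rewrite mulNr oppr_lt0 divr_gt0// exprn_gt0.
Qed.

Lemma mills_lt_cubic x : 0 < x ->
  (1 + x ^+ 2) * mills x - x < 3 / (1 + x) ^+ 3.
Proof.
move=> x0; have q0 t : 0 < 1 + t ^+ 2 :> R by rewrite ltr_pwDl ?sqr_ge0.
rewrite ltrBlDl mulrC -ltr_pdivlMr ?q0//.
pose dU (t : R) := ((1 - 9 / (1 + t) ^+ 4) * (1 + t ^+ 2)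
  - 2 * t * (t + 3 / (1 + t) ^+ 3)) / (1 + t ^+ 2) ^+ 2.
apply: (@mills_lt (fun t => (t + 3 / (1 + t) ^+ 3) / (1 + t ^+ 2)) dU) => // t t0.
- have qn : 1 + t ^+ 2 != 0 by rewrite gt_eqF.
  have t1 : 1 + t != 0 by rewrite gt_eqF// addr_gt0.
  have t13 : (1 + t) ^+ 3 != 0 by rewrite expf_neq0.
  apply: is_derive_eq; rewrite /dU /GRing.scale/= /cst/=; field.
  by rewrite t1 qn.
- by rewrite /= divr_ge0 ?ltW// addr_gt0// divr_gt0// exprn_gt0// addr_gt0.
- have qn : 1 + t ^+ 2 != 0 by rewrite gt_eqF.
  have t1 : 0 < 1 + t by rewrite addr_gt0.
  (* The numerator t^4 - 5 t^3 + 6 t^2 + t + 7, as a sum of squares. *)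
  rewrite /= -subr_lt0 (_ : _ - _ =
    - ((t ^+ 2 - 5 / 2 * t - 1) ^+ 2 + 7 / 4 * (t - 8 / 7) ^+ 2 + 26 / 7)
    / ((1 + t ^+ 2) ^+ 2 * (1 + t) ^+ 4)).
    rewrite mulNr oppr_lt0 divr_gt0 ?mulr_gt0 ?exprn_gt0//.
    have := sqr_ge0 (t ^+ 2 - 5 / 2 * t - 1); have := sqr_ge0 (t - 8 / 7); lra.
  by rewrite /dU; field; rewrite qn gt_eqF.
Qed.

End mills_ratio.

Section stein_solution.
Context {R : realType}.
Implicit Types x y z w : R.

Definition stein_h x : R := (1 + x ^+ 2) * mills x - x.

Lemma stein_h_decreasing x y : x < y -> stein_h y < stein_h x.
Proof.
pose dh t : R := (t ^+ 3 + 3 * t) * mills t - (t ^+ 2 + 2).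
apply: (@derive_neg_decreasing _ stein_h dh) => t _.
  have dm := is_derive_mills t.
  by apply: is_derive_eq; rewrite /dh /GRing.scale/= /cst/=; ring.
have [t0|t0] := ltP 0 t; first by rewrite subr_lt0 mills_lt_rational.
rewrite /dh (_ : _ - _ = t * ((t ^+ 2 + 3) * mills t) - (t ^+ 2 + 2)); last by ring.
have m0 : 0 <= (t ^+ 2 + 3) * mills t.
  by rewrite mulr_ge0 ?addr_ge0 ?sqr_ge0// ltW ?mills_gt0.
have : t * ((t ^+ 2 + 3) * mills t) <= 0 by rewrite mulr_le0_ge0.
have := sqr_ge0 t; lra.
Qed.

Lemma millsN x : mills (- x) = Num.sqrt (2 * pi) * expR (x ^+ 2 / 2) * Phi x.
Proof. by rewrite /mills sqrrN PhiN; congr (_ * _); ring. Qed.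

Lemma stein_g_formulaE z w : stein_g_formula z w =
  if z < w then stein_h w * Phi z else stein_h (- w) * (1 - Phi z).
Proof.
rewrite /stein_g_formula /stein_h; case: ifP => _; first by rewrite /mills; ring.
by rewrite millsN sqrrN; ring.
Qed.

Definition stein_solution z w : R :=
  Num.sqrt (2 * pi) * expR (w ^+ 2 / 2)
  * Phi (Num.min w z) * (1 - Phi (Num.max w z)).

Lemma stein_solution_le z w : w <= z ->
  stein_solution z w = mills (- w) * (1 - Phi z).
Proof. by move=> wz; rewrite /stein_solution min_l// max_r// millsN. Qed.

Lemma stein_solution_ge z w : z <= w ->
  stein_solution z w = mills w * Phi z.
Proof. by move=> wz; rewrite /stein_solution min_r// max_l// /mills; ring. Qed.

Lemma continuous_Phi : continuous (@Phi R).
Proof. by move=> x; exact: is_derive_continuous (is_derive_Phi x). Qed.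

Lemma stein_solution_continuous z : continuous (stein_solution z).
Proof.
move=> w; apply: cvgM; first apply: cvgM; first apply: cvgM.
- exact: cvg_cst.
- exact: is_derive_continuous (is_derive_expR_sqr_half w).
- apply: (continuous_comp (f := fun x => Num.min x z)); last exact: continuous_Phi.
  by apply: continuous_min; [exact: cvg_id|exact: cvg_cst].
- apply: cvgB; first exact: cvg_cst.
  apply: (continuous_comp (f := fun x => Num.max x z)); last exact: continuous_Phi.
  by apply: continuous_max; [exact: cvg_id|exact: cvg_cst].
Qed.

Lemma Phi_nondecreasing x y : x <= y -> Phi x <= Phi y.
Proof. by rewrite le_eqVlt => /predU1P[->|/Phi_increasing/ltW]. Qed.

Lemma mills_lt4 x : 0 < x -> mills x < 4.
Proof.
move=> x0; have h := mills_lt_cubic x x0; rewrite ltNge; apply/negP => m4.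
have : 3 / (1 + x) ^+ 3 <= 3.
  rewrite ler_pdivrMr ?exprn_gt0 ?addr_gt0// ler_peMr// exprn_ege1//.
  by rewrite lerDl ltW.
have : (1 + x ^+ 2) * 4 <= (1 + x ^+ 2) * mills x.
  by rewrite ler_wpM2l// addr_ge0// sqr_ge0.
have := sqr_ge0 (x - 1 / 8); nra.
Qed.

Lemma stein_solution_ge0 z w : 0 <= stein_solution z w.
Proof.
rewrite mulr_ge0 ?subr_ge0 ?(ltW (Phi_lt1 _))//.
by rewrite mulr_ge0 ?(ltW (Phi_gt0 _))// mulr_ge0 ?sqrtr_ge0 ?expR_ge0.
Qed.

Lemma stein_solution_bounded z : bounded_fun (stein_solution z).
Proof.
have gT : ProperFilter (globally [set: R]).
  exact: (@globally_properfilter _ _ 0).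
apply/ex_bound; exists (4 + mills 0) => w _ /=.
rewrite ger0_norm ?stein_solution_ge0//.
have m0 := mills_gt0 (0 : R).
have P1 := Phi_lt1 z; have P0 := Phi_gt0 z.
have c0 : 0 <= Num.sqrt (2 * pi) * expR (w ^+ 2 / 2) :> R.
  by rewrite mulr_ge0 ?expR_ge0 ?sqrtr_ge0.
have le1 : stein_solution z w <= mills w.
  rewrite /stein_solution /mills -mulrA ler_wpM2l//.
  apply: (@le_trans _ _ (1 * (1 - Phi w))); last by rewrite mul1r.
  rewrite ler_pM// ?subr_ge0 ?(ltW (Phi_lt1 _)) ?(ltW (Phi_gt0 _))//.
  by rewrite lerB// Phi_nondecreasing// le_max lexx.
have le2 : stein_solution z w <= mills (- w).
  rewrite millsN /stein_solution -mulrA ler_wpM2l//.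
  apply: (@le_trans _ _ (Phi w * 1)); last by rewrite mulr1.
  rewrite ler_pM// ?subr_ge0 ?(ltW (Phi_lt1 _)) ?(ltW (Phi_gt0 _))//.
    by rewrite Phi_nondecreasing// ge_min lexx.
  by rewrite gerBl ltW// Phi_gt0.
have [w0|w0|w0] := ltgtP w 0.
- have : 0 < - w by lra.
  by move=> /mills_lt4; lra.
- by have := mills_lt4 w w0; lra.
- by move: le1; rewrite w0; lra.
Qed.

Lemma is_derive_stein_solution z w : w != z ->
  is_derive w 1 (stein_solution z)
    (w * stein_solution z w + (w <= z)%R%:R - Phi z).
Proof.
have [wz _|zw _|//] := ltgtP w z.
- apply: (@near_eq_is_derive _ _ _ (fun t => mills (- t) * (1 - Phi z))).
    near=> t; rewrite stein_solution_le//; near: t; exact: lt_le_nbhsl.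
  have dm : is_derive w 1 (fun t => mills (- t)) ((- w * mills (- w) - 1) * -1).
    by apply: (@is_derive1_comp R mills -%R); exact: is_derive_mills.
  apply: is_derive_eq; rewrite stein_solution_le 1?ltW// /GRing.scale/= /cst/=.
  ring.
- apply: (@near_eq_is_derive _ _ _ (fun t => mills t * Phi z)).
    near=> t; rewrite stein_solution_ge//; near: t; exact: lt_le_nbhsr.
  have dm := is_derive_mills w.
  apply: is_derive_eq; rewrite stein_solution_ge 1?ltW// /GRing.scale/= /cst/=.
  ring.
Unshelve. all: by end_near. Qed.

Lemma stein_solutionP z : bounded_stein_solution z (stein_solution z).
Proof.
split; [exact: stein_solution_continuous|exact: stein_solution_bounded|].
move=> w wz; have [dw dE] := is_derive_stein_solution z w wz.
by split => //; rewrite derive1E dE; ring.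
Qed.

Lemma stein_solution_unique z (f g : R -> R) :
  bounded_stein_solution z f -> bounded_stein_solution z g -> f = g.
Proof.
move=> [fc fb fE] [gc gb gE].
pose d t : R := (f t - g t) * expR (- t ^+ 2 / 2).
have dc : continuous d.
  move=> t; apply: cvgM; first by apply: cvgB; [exact: fc|exact: gc].
  exact: is_derive_continuous (is_derive_expRN_sqr_half t).
have dd (t : R) : t != z -> is_derive t 1 d 0.
  move=> tz; have [df fEt] := fE t tz; have [dg gEt] := gE t tz.
  have f' : is_derive t 1 f (derive1 f t) by rewrite derive1E; exact/derivableP.
  have g' : is_derive t 1 g (derive1 g t) by rewrite derive1E; exact/derivableP.
  have e' := is_derive_expRN_sqr_half t.
  apply: is_derive_eq; rewrite /GRing.scale/=.
  have -> : derive1 f t = t * f t + ((t <= z)%R%:R - Phi z) by rewrite -fEt; ring.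
  have -> : derive1 g t = t * g t + ((t <= z)%R%:R - Phi z) by rewrite -gEt; ring.
  ring.
have dcst a b : a < b -> (b <= z \/ z <= a) -> d a = d b.
  move=> ab zab; apply/esym/eqP; rewrite -subr_eq0.
  have [||c _ ->] := @MVT R d (fun=> 0) a b ab.
  - move=> t; rewrite in_itv/= => /andP[at_ tb]; apply: dd.
    by case: zab => h; [rewrite lt_eqF// (lt_le_trans tb)|rewrite gt_eqF// (le_lt_trans h)].
  - exact: continuous_subspaceT.
  - by rewrite mul0r.
have dz w : d w = d z.
  have [wz|zw|->//] := ltgtP w z; first by apply: dcst => //; left.
  by apply/esym; apply: dcst => //; right.
have fgE w : f w - g w = d z * expR (w ^+ 2 / 2).
  by rewrite -(dz w) /d -mulrA expR_sqr_halfM mulr1.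
have gT : ProperFilter (globally [set: R]).
  exact: (@globally_properfilter _ _ 0).
move/ex_bound : fb => [Mf fM]; move/ex_bound : gb => [Mg gM].
have le_M w : `|d z| * (1 + w ^+ 2 / 2) <= Mf + Mg.
  have /= := fM w I; have /= := gM w I => gw fw.
  apply: (@le_trans _ _ `|f w - g w|); last first.
    by rewrite (le_trans (ler_normB _ _))// lerD.
  rewrite fgE [leRHS]normrM ler_wpM2l// ger0_norm ?expR_ge0//; exact: expR_ge1Dx.
apply/funext => w; apply/eqP; rewrite -subr_eq0 fgE mulf_eq0.
apply/orP; left; rewrite -normr_eq0; apply/negPn/negP => dz0.
have {}dz0 : 0 < `|d z| by rewrite lt_def dz0/=.
have := le_M (1 + (Mf + Mg) / `|d z|).
set b := (Mf + Mg) / `|d z|.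
have -> : Mf + Mg = `|d z| * b by rewrite /b mulrC divfK// gt_eqF.
rewrite ler_pM2l//; have := sqr_ge0 b; nra.
Qed.

Lemma stein_g_solution z w : stein_g z (stein_solution z) w = stein_g_formula z w.
Proof.
rewrite /stein_g; have [->//|wz] := eqVneq w z.
have dw := is_derive_stein_solution z w wz.
have -> : derive1 (fun x => x * stein_solution z x) w =
    (1 + w ^+ 2) * stein_solution z w + w * ((w <= z)%R%:R - Phi z).
  rewrite derive1E.
  have dM : is_derive w 1 (fun x => x * stein_solution z x)
      ((1 + w ^+ 2) * stein_solution z w + w * ((w <= z)%R%:R - Phi z)).
    by apply: is_derive_eq; rewrite /GRing.scale/=; ring.
  by rewrite derive_val.
rewrite stein_g_formulaE /stein_h; case: (ltgtP w z) wz => // [wz|zw] _.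
- by rewrite stein_solution_le 1?ltW// sqrrN /=; ring.
- by rewrite stein_solution_ge 1?ltW// /=; ring.
Qed.

End stein_solution.

Theorem lemma3p1 (R : realType) (z : R) (z_gt0 : 0 < z) :
  (exists! f : R -> R, bounded_stein_solution z f) /\
  forall f : R -> R, bounded_stein_solution z f ->
    [/\ forall w : R, stein_g z f w = stein_g_formula z w,
        (forall x y : R, x < y -> y <= z -> stein_g z f x < stein_g z f y) /\
        (forall x y : R, z < x -> x < y -> stein_g z f y < stein_g z f x),
        forall w : R, w < 0 -> stein_g z f w <= 3 / (2 * (1 - w) ^+ 3) &
        forall w : R, z < w -> stein_g z f w <= 3 / (1 + w) ^+ 3].
Proof.
split.
  exists (stein_solution z); split; first exact: stein_solutionP.
  by move=> f /(stein_solution_unique z _ _ (stein_solutionP z)).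
move=> f /(stein_solution_unique z _ _ (stein_solutionP z)) <-.
have P0 := Phi_gt0 z; have P1 := Phi_lt1 z.
have gE w : stein_g z (stein_solution z) w =
    if z < w then stein_h w * Phi z else stein_h (- w) * (1 - Phi z).
  by rewrite stein_g_solution stein_g_formulaE.
split.
- exact: stein_g_solution.
- split=> x y.
    move=> xy yz; rewrite !gE !ifF; last 2 first.
      by apply/negbTE; rewrite -leNgt.
      by apply/negbTE; rewrite -leNgt (le_trans (ltW xy)).
    by rewrite ltr_pM2r ?subr_gt0// stein_h_decreasing// ltrN2.
  move=> zx xy; rewrite !gE zx (lt_trans zx xy).
  by rewrite ltr_pM2r// stein_h_decreasing.
- move=> w w0; rewrite gE ifF; last first.
    by apply/negbTE; rewrite -leNgt ltW// (lt_trans w0).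
  have w1 : 0 < - w by rewrite oppr_gt0.
  have := mills_lt_cubic _ w1; rewrite -/(stein_h (- w)) => /ltW hw.
  apply: (@le_trans _ _ (3 / (1 - w) ^+ 3 * (1 - Phi z))).
    by rewrite ler_pM2r// subr_gt0.
  rewrite [leRHS](_ : _ = 3 / (1 - w) ^+ 3 * 2^-1); last by rewrite invfM mulrA mulrAC.
  rewrite ler_wpM2l//.
    by rewrite divr_ge0// exprn_ge0// addr_ge0// ltW.
  by have := Phi_ge_half z (ltW z_gt0); lra.
- move=> w zw; rewrite gE zw.
  have w0 := lt_trans z_gt0 zw.
  have w3 : 0 <= 3 / (1 + w) ^+ 3 by rewrite divr_ge0// exprn_ge0// addr_ge0// ltW.
  apply: (@le_trans _ _ (3 / (1 + w) ^+ 3 * Phi z)); last by rewrite ler_piMr// ltW.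
  by rewrite ler_pM2r// ltW// mills_lt_cubic.
Qed.
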